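(* Let $m\ge 2$, $a,b\in\mathbb{F}_q$ and $f=x^{r^m}+ax^r+bx$. There is a one-to-one correspondence between any two of the following sets: - the right components of $f$ of degree $r$ in $\mathbb{F}_q[x;r]$, - the roots of $\Psi_m^{(a,b)}$ in $\mathbb{F}_q$, - the $\sigma_q$-invariant $\mathbb{F}_r$-linear subspaces of $V_f$ of dimension $1$.
   Context: Let $r$ be a power of a prime $p$ (with $r>1$) and $q=r^d$ for a positive integer $d$. $\mathbb{F}_q[x;r]=\{\sum_{0\le i\le n}a_ix^{r^i}: n\ge 0,\ a_i\in\mathbb{F}_q\}$ is the ring (under addition and composition) of $r$-additive polynomials over $\mathbb{F}_q$. A right component of $f$ is a monic polynomial $h\in\mathbb{F}_q[x;r]$ with $f=g\circ h=g(h)$ for some $g\in\mathbb{F}_q[x;r]$. The projective polynomial is $\Psi_m^{(a,b)}=x^{(r^m-1)/(r-1)}+ax+b$. $V_f$ is the $\mathbb{F}_r$-vector space of all roots of $f$ in an algebraic closure $\overline{\mathbb{F}}_q$ of $\mathbb{F}_q$, and $\sigma_q$ is the Frobenius automorphism $\alpha\mapsto\alpha^q$, acting $\mathbb{F}_r$-linearly on $V_f$.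
   Formalization: The two correspondences with invariant subspaces are stated only for b ≠ 0, since for b = 0 the root 0 and the component x^r have no matching line in V_f (e.g. a = b = 0 gives V_f = {0}); components and roots correspond for all a, b. *)

(* Defs.v *)
From HB Require Import structures.
From mathcomp Require Import all_boot all_order all_algebra.
From mathcomp Require Import boolp classical_sets functions.

Set Implicit Arguments.
Unset Strict Implicit.
Unset Printing Implicit Defensive.

Import GRing.Theory.
Local Open Scope ring_scope.
Local Open Scope classical_set_scope.

Section AdditivePolynomials.
Variables (R : nzRingType) (r : nat).

Definition additive_poly : set {poly R} :=
  [set f | exists (n : nat) (a : nat -> R),
             f = \sum_(0 <= i < n.+1) a i *: 'X^(r ^ i)].

(* [g \Po h] is the composition g(h), so [h] is the inner factor. *)
Definition right_component (f : {poly R}) : set {poly R} :=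
  [set h | [/\ h \is monic, additive_poly h
             & exists2 g, additive_poly g & f = g \Po h]].

(* [size h] is one more than the degree of [h]. *)
Definition right_component_deg (n : nat) (f : {poly R}) : set {poly R} :=
  [set h | right_component f h /\ size h = n.+1].

Definition projective_poly (m : nat) (a b : R) : {poly R} :=
  'X^((r ^ m - 1) %/ (r - 1)) + a *: 'X + b%:P.

Definition additive_trinomial (m : nat) (a b : R) : {poly R} :=
  'X^(r ^ m) + a *: 'X^r + b *: 'X.

End AdditivePolynomials.

Section RootSpace.
(* The tower Fr -> F -> K, where K is meant to be an algebraic closure of F;
   Fr acts on K by multiplication through the composite embedding. *)
Variables (Fr F : finFieldType) (K : closedFieldType).
Variables (j : {rmorphism Fr -> F}) (iota : {rmorphism F -> K}).

Definition Fr_scale (c : Fr) (v : K) : K := iota (j c) * v.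

(* The roots are taken without multiplicity. *)
Definition root_space (f : {poly F}) : set K :=
  [set x | root (map_poly iota f) x].

Definition linear_subspace (U : set K) : Prop :=
  U 0 /\ forall (c : Fr) (u v : K), U u -> U v -> U (Fr_scale c u + v).

Definition lin_comb n (e : 'I_n -> K) (c : 'I_n -> Fr) : K :=
  \sum_(i < n) Fr_scale (c i) (e i).

Definition lin_independent n (e : 'I_n -> K) : Prop :=
  forall c : 'I_n -> Fr, lin_comb e c = 0 -> forall i, c i = 0.

Definition has_dim (n : nat) (U : set K) : Prop :=
  exists2 e : 'I_n -> K, lin_independent e & U = range (lin_comb e).

Definition frobenius (x : K) : K := x ^+ #|F|.

Definition invariant_subspaces (n : nat) (f : {poly F}) : set (set K) :=
  [set U | [/\ linear_subspace U, U `<=` root_space f, has_dim n U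
             & frobenius @` U `<=` U]].

End RootSpace.

Definition one_to_one (T1 T2 : Type) (A : set T1) (B : set T2) : Prop :=
  exists phi : T1 -> T2, set_bij A B phi.

(* Main.v *)
(** Modulo [x^r - c x] on the right, [x^(r^i)] reduces to
    [c^((r^i-1)/(r-1)) x], so [f] reduces to [Psi(c) x]; since degrees of
    composites with [x^r - c x] are multiples of [r], this linear polynomial is
    a composite only when it vanishes.  Hence [x^r - c x] is a right component
    exactly when [Psi(c) = 0].  The root space of [x^r - c x], for [c] nonzero
    in [F], is a Frobenius-invariant [Fr]-line; conversely a generator [v] of
    such a line gives [c = v^(r-1)], which Frobenius fixes. *)

Require Import Defs.
From HB Require Import structures.
From mathcomp Require Import all_boot all_order all_algebra.
From mathcomp Require Import finfield.
From mathcomp Require Import boolp classical_sets functions.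
Import GRing.Theory.
Local Open Scope ring_scope.
Local Open Scope classical_set_scope.

Set Implicit Arguments.
Unset Strict Implicit.
Unset Printing Implicit Defensive.

(** * Preliminaries: composing bijections, the exponents (r^i-1)/(r-1), r-th powers of sums *)

Lemma one_to_one_trans (T1 T2 T3 : Type) (A : set T1) (B : set T2)
    (C : set T3) :
  one_to_one A B -> one_to_one B C -> one_to_one A C.
Proof. by case=> f bf [g bg]; exists (g \o f); exact: set_bij_comp bf bg. Qed.

(** The exponent is the geometric sum 1 + r + ... + r^(i-1); the truncated division is exact because
    r - 1 divides r^i - 1. *)
Lemma geom_exponent_rec (r i : nat) : (1 < r)%N ->
  ((r ^ i.+1 - 1) %/ (r - 1) = r * ((r ^ i - 1) %/ (r - 1)) + 1)%N.
Proof.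
move=> r_gt1; have r1_gt0 : (0 < r - 1)%N by rewrite subn_gt0.
have dv : (r - 1 %| r ^ i - 1)%N by rewrite !subn1 predn_exp dvdn_mulr.
have -> : (r ^ i.+1 - 1 = r * (r ^ i - 1) + (r - 1))%N.
  rewrite expnS mulnBr muln1 addnBA ?(ltnW r_gt1) // subnK //.
  by rewrite leq_pmulr // expn_gt0 ltnW.
by rewrite divnDr // muln_divA // divnn r1_gt0.
Qed.

Lemma geom_exponent_gt0 (r i : nat) : (1 < r)%N -> (0 < i)%N ->
  (0 < (r ^ i - 1) %/ (r - 1))%N.
Proof. by case: i => // i r_gt1 _; rewrite geom_exponent_rec // addn1. Qed.

Lemma horner_projective_poly (R : comNzRingType) (r m : nat) (a b c : R) :
  (projective_poly r m a b).[c] = c ^+ ((r ^ m - 1) %/ (r - 1)) + a * c + b.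
Proof. by rewrite /projective_poly !hornerE. Qed.

Lemma expr_tower (R : comNzRingType) (r i : nat) (c v : R) : (1 < r)%N ->
  v ^+ r = c * v -> v ^+ (r ^ i) = c ^+ ((r ^ i - 1) %/ (r - 1)) * v.
Proof.
move=> r_gt1 vr; elim: i => [|i IH]; first by rewrite subnn div0n mul1r.
rewrite geom_exponent_rec // expnSr exprM IH exprMn vr -exprM mulnC mulrA.
by rewrite -exprSr addn1.
Qed.

Section FrobeniusPower.
Variables (R : comNzRingType) (r : nat).
Hypothesis pchar_r : [pchar R].-nat r.

Lemma expr_sum_pchar (I : Type) (s : seq I) (G : I -> R) :
  (\sum_(i <- s) G i) ^+ r = \sum_(i <- s) G i ^+ r.
Proof.
have r_gt0 : (0 < r)%N by case/andP: pchar_r.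
elim: s => [|i s IH]; first by rewrite !big_nil expr0n eqn0Ngt r_gt0.
by rewrite !big_cons exprDn_pchar // IH.
Qed.

End FrobeniusPower.

(** * Additive polynomials and their reduction modulo x^r - c x *)

Section AdditivePoly.
Variables (F : fieldType) (r : nat).
Hypothesis r_gt1 : (1 < r)%N.
Implicit Types (c : F) (f g h : {poly F}).

Lemma additive_polyZX c i : additive_poly r (c *: 'X^(r ^ i)).
Proof.
exists i, (fun l => if l == i then c else 0).
rewrite big_nat_recr //= eqxx big1_seq ?add0r // => l.
by rewrite mem_index_iota => /andP[_ li]; rewrite ltn_eqF // scale0r.
Qed.

Lemma additive_poly0 : additive_poly r (0 : {poly F}).
Proof. by rewrite -(scale0r 'X^(r ^ 0)); apply: additive_polyZX. Qed.

Lemma additive_polyX : additive_poly r ('X : {poly F}).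
Proof. by rewrite -(scale1r 'X); apply: (additive_polyZX 1 0). Qed.

Lemma additive_polyD f g :
  additive_poly r f -> additive_poly r g -> additive_poly r (f + g).
Proof.
(* The summands may have different lengths; zero coefficients bring both to length n1 + n2. *)
have pad n N (a : nat -> F) : (n <= N)%N ->
    \sum_(0 <= i < n.+1) a i *: 'X^(r ^ i) =
    \sum_(0 <= i < N.+1) (if (i < n.+1)%N then a i else 0) *: 'X^(r ^ i).
  move=> nN; rewrite (@big_nat_widen _ _ _ 0%N n.+1 N.+1) //= big_mkcond.
  by apply: eq_bigr => i _; case: ifP => // _; rewrite scale0r.
case=> n1 [a1 ->] [n2 [a2 ->]].
rewrite (pad n1 (n1 + n2)%N) ?leq_addr // (pad n2 (n1 + n2)%N) ?leq_addl //.
rewrite -big_split /=; eexists (n1 + n2)%N, (fun i => _).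
by under eq_bigr do rewrite -scalerDl.
Qed.

Lemma additive_polyZ c f : additive_poly r f -> additive_poly r (c *: f).
Proof.
case=> n [a ->]; exists n, (fun i => c * a i).
by rewrite scaler_sumr; apply: eq_bigr => i _; rewrite scalerA.
Qed.

Lemma additive_poly_expr f : [pchar F].-nat r ->
  additive_poly r f -> additive_poly r (f ^+ r).
Proof.
move=> pchar_r [n [a ->]].
rewrite expr_sum_pchar; last by rewrite (eq_pnat _ (pchar_poly F)).
exists n.+1, (fun i => if i is i'.+1 then a i' ^+ r else 0).
rewrite [RHS]big_nat_recl //= scale0r add0r.
by apply: eq_bigr => i _; rewrite exprZn -exprM -expnSr.
Qed.

(** The only power of r below r is r^0 = 1, so once the leading coefficient is fixed only the
    coefficient of X is free. *)
Lemma additive_poly_degr h : additive_poly r h -> h \is monic ->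
  size h = r.+1 -> h = 'X^r + h`_1 *: 'X.
Proof.
move=> [n [a hE]] /monicP lead_h size_h; apply/polyP => i.
rewrite coefD coefXn coefZ coefX.
have [->|i_neq1] := eqVneq i 1%N; first by rewrite ltn_eqF // mulr1 add0r.
rewrite mulr0 addr0.
have [->|i_neqr] := eqVneq i r; first by rewrite -lead_h lead_coefE size_h.
have [i_ltr|i_ger] := ltnP i r; last first.
  by rewrite nth_default // size_h ltn_neqAle eq_sym i_neqr.
rewrite hE coef_sum big1_seq // => l _; rewrite coefZ coefXn.
case: eqP => [iE|]; last by rewrite mulr0.
case: l iE => [|l] iE; first by rewrite iE expn0 in i_neq1.
by move: i_ltr; rewrite iE expnS ltnNge leq_pmulr // expn_gt0 ltnW.
Qed.

Lemma size_linear_binomial c : size ('X^r - c *: 'X : {poly F}) = r.+1.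
Proof.
rewrite size_polyDl size_polyXn // size_polyN.
by apply: leq_ltn_trans (size_scale_leq _ _) _; rewrite size_polyX.
Qed.

Lemma monic_linear_binomial c : 'X^r - c *: 'X \is @monic F.
Proof.
by rewrite monicE lead_coefE size_linear_binomial coefB coefXn eqxx coefZ coefX
  (gtn_eqF r_gt1) mulr0 subr0.
Qed.

Lemma additive_linear_binomial c : additive_poly r ('X^r - c *: 'X).
Proof.
apply: additive_polyD; first by have := additive_polyZX 1 1; rewrite scale1r.
by rewrite -scaleNr; apply: additive_polyZ additive_polyX.
Qed.

Lemma expX_mod_binomial c i : [pchar F].-nat r ->
  exists2 G, additive_poly r G &
    'X^(r ^ i) = c ^+ ((r ^ i - 1) %/ (r - 1)) *: 'X + (G \Po ('X^r - c *: 'X)).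
Proof.
move=> pchar_r; elim: i => [|i [G addG IH]].
  exists 0; first exact: additive_poly0.
  by rewrite subnn div0n expr0 scale1r comp_poly0 addr0.
set N := ((r ^ i - 1) %/ (r - 1))%N in IH *.
(* Write B = X^r - c X. The r-th power of c^N X + G(B) is c^(rN) X^r + G^r(B), and X^r = c X + B
   splits the first term into c^(rN+1) X and c^(rN) B. *)
exists (c ^+ (r * N) *: 'X + G ^+ r).
  apply: additive_polyD; last exact: additive_poly_expr.
  exact: additive_polyZ additive_polyX.
rewrite geom_exponent_rec // -/N expnSr exprM IH.
rewrite exprDn_pchar ?(eq_pnat _ (pchar_poly F)) // exprZn -exprM.
rewrite comp_polyD comp_polyZ comp_polyX (mulnC N) exprD expr1.
rewrite scalerBr scalerA addrA addrCA subrr addr0.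
by rewrite (rmorphXn (comp_poly _)).
Qed.

Lemma trinomial_mod_binomial m a b c : [pchar F].-nat r ->
  exists2 G, additive_poly r G &
    additive_trinomial r m a b =
      (projective_poly r m a b).[c] *: 'X + (G \Po ('X^r - c *: 'X)).
Proof.
move=> pchar_r; have [G addG GE] := expX_mod_binomial c m pchar_r.
(* Only X^(r^m) needs the iterated reduction: a X^r adds a X to the outer factor and a c X to the
   remainder. *)
exists (G + a *: 'X); first exact/additive_polyD/additive_polyZ/additive_polyX.
rewrite horner_projective_poly /additive_trinomial GE comp_polyD comp_polyZ.
rewrite comp_polyX scalerBr scalerA !scalerDl.
rewrite -!addrA; congr (_ + _).
by rewrite [RHS]addrC -!addrA addNr addr0 addrA addrC.
Qed.

End AdditivePoly.

(** * Right components of degree r and roots of Psi *)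

Lemma components_roots_bij (F : finFieldType) (r m : nat) (a b : F) :
  (1 < r)%N -> [pchar F].-nat r ->
  one_to_one (right_component_deg r r (additive_trinomial r m a b))
             [set c : F | root (projective_poly r m a b) c].
Proof.
(* A component has the form X^r - c X, so c is minus its coefficient of X. *)
move=> r_gt1 pchar_r; exists (fun h => - h`_1).
have hE h : right_component_deg r r (additive_trinomial r m a b) h ->
    h = 'X^r - (- h`_1) *: 'X.
  case=> -[mon_h add_h _] size_h.
  by rewrite scaleNr opprK -additive_poly_degr.
split.
- move=> h comp_h; have hE' := hE h comp_h.
  case: comp_h => -[_ _ [g _ fE]] size_h; set c := - h`_1 in hE' *.
  have [G _ fE'] := trinomial_mod_binomial r_gt1 m a b c pchar_r.
  rewrite -hE' in fE'.
  (* The linear remainder [Psi(c) X] is a composite [(g - G)(h)], so its degree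
     is a multiple of [r], hence is not 1. *)
  have /(congr1 (fun p : {poly F} => (size p).-1)) :
      (projective_poly r m a b).[c] *: 'X = (g - G) \Po h.
    by rewrite comp_polyB -fE fE' addrK.
  rewrite size_comp_poly size_h /= rootE.
  have [//|nz] := eqVneq (projective_poly r m a b).[c] 0.
  rewrite size_scale // size_polyX /= => /esym/eqP.
  by rewrite muln_eq1 andbC gtn_eqF.
- move=> h1 h2; rewrite !inE => /hE E1 /hE E2 eq_c.
  by rewrite E1 E2 eq_c.
- move=> c /rootP root_c; exists ('X^r - c *: 'X); last first.
    by rewrite /= coefB coefXn coefZ coefX ltn_eqF // mulr1 sub0r opprK.
  have [G addG fE] := trinomial_mod_binomial r_gt1 m a b c pchar_r.
  split; last exact: size_linear_binomial.
  split; [exact: monic_linear_binomial | exact: additive_linear_binomial |].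
  by exists G => //; rewrite fE root_c scale0r add0r.
Qed.

(** X^#|E| - X is the product of the X - x over E, so its roots in [K] are images of elements of E.
    Applied to [Fr] it yields scalars, applied to [F] it yields the parameter c. *)
Lemma fixed_expr_card (E : finFieldType) (K : idomainType)
    (e : {rmorphism E -> K}) (y : K) :
  y ^+ #|E| = y -> exists x, e x = y.
Proof.
move=> yE; have /(congr1 (map_poly e)) := finField_genPoly E.
rewrite rmorphB /= map_polyXn map_polyX map_prod_XsubC.
move/(congr1 (horner^~ y)); rewrite !hornerE yE subrr horner_prod => /esym/eqP.
case/prodf_eq0 => x _; rewrite hornerXsubC subr_eq0 => /eqP ->.
by exists x.
Qed.

(** * Roots of Psi and Frobenius-invariant lines *)

Section Lines.
Variables (Fr F : finFieldType) (K : closedFieldType).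
Variables (j : {rmorphism Fr -> F}) (iota : {rmorphism F -> K}).
Let r := #|Fr|.
Hypothesis pchar_r : [pchar K].-nat r.
Implicit Types (c : F) (u v : K).

(** The root set in [K] of the component x^r - c x; it is a line for c nonzero and shrinks to zero
    for c = 0. *)
Definition frobenius_line c : set K := [set x | x ^+ r = iota c * x].

Lemma has_dim1P (U : set K) :
  has_dim j iota 1 U <->
  exists2 v, v != 0 & U = range (fun s => Fr_scale j iota s v).
Proof.
have lcE (e : 'I_1 -> K) s : lin_comb j iota e s =
    Fr_scale j iota (s ord0) (e ord0) by rewrite /lin_comb big_ord1.
split=> [[e indep ->]|[v v_neq0 ->]].
  exists (e ord0).
    apply/eqP => e0; have /(_ _ ord0)/eqP := indep (fun=> 1).
    by rewrite oner_eq0 lcE /Fr_scale e0 mulr0 => /(_ erefl).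
  apply/seteqP; split=> x [s _ <-].
    by exists (s ord0) => //; rewrite lcE.
  by exists (fun=> s) => //; rewrite lcE.
exists (fun=> v) => [s|].
  rewrite lcE /Fr_scale => /eqP; rewrite mulf_eq0 (negPf v_neq0) orbF.
  by rewrite !fmorph_eq0 => /eqP s0 i; rewrite ord1.
apply/seteqP; split=> x [s _ <-].
  by exists (fun=> s) => //; rewrite lcE.
by exists (s ord0) => //; rewrite lcE.
Qed.

Lemma expr_Fr_scale s v : Fr_scale j iota s v ^+ r = Fr_scale j iota s (v ^+ r).
Proof. by rewrite /Fr_scale exprMn -!rmorphXn expf_card. Qed.

(** The quotient of two solutions is fixed by the r-th power, hence is a scalar from [Fr]. The
    nonzero solution v forces c to be nonzero, so c cancels. *)
Lemma frobenius_line_span c v : v != 0 -> frobenius_line c v ->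
  frobenius_line c = range (fun s => Fr_scale j iota s v).
Proof.
move=> v_neq0 vr; apply/seteqP; split=> x; last first.
  case=> s _ <-; rewrite /frobenius_line /=.
  by rewrite expr_Fr_scale vr /Fr_scale mulrCA.
rewrite /frobenius_line /= => xr; have [s sE] : exists s, (iota \o j) s = x / v.
  apply: fixed_expr_card; rewrite -/r expr_div_n xr vr.
  have [c0|c_neq0] := eqVneq (iota c) 0.
    by move/eqP: vr; rewrite c0 mul0r expf_eq0 (negPf v_neq0) andbF.
  by rewrite -mulf_div divff // mul1r.
by exists s => //; move: sE => /= sE; rewrite /Fr_scale sE divfK.
Qed.

Lemma frobenius_line_neq0 c : c != 0 ->
  exists2 v, v != 0 & frobenius_line c v.
Proof.
move=> c_neq0; have r1_gt0 : (0 < r.-1)%N.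
  by rewrite -subn1 subn_gt0 finNzRing_gt1.
(* Algebraic closedness provides v with v^(r-1) = c. *)
have [v vE] := solve_monicpoly (fun i => if i == 0%N then iota c else 0) r1_gt0.
have {}vE : v ^+ r.-1 = iota c.
  rewrite vE -(prednK r1_gt0) big_ord_recl /= expr0 mulr1 big1 ?addr0 // => i _.
  by rewrite mul0r.
exists v; last first.
  rewrite /frobenius_line /= -vE -exprSr prednK // ltnW //.
  exact: finNzRing_gt1.
apply/eqP => v0; move/eqP: vE.
by rewrite v0 expr0n gtn_eqF // eq_sym fmorph_eq0 (negPf c_neq0).
Qed.

Lemma frobenius_line_subspace c : linear_subspace j iota (frobenius_line c).
Proof.
split=> [|s u v]; first last.
  rewrite /frobenius_line /= => ur vr.
  rewrite exprDn_pchar // expr_Fr_scale ur vr.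
  by rewrite /Fr_scale mulrDr mulrCA.
rewrite /frobenius_line /= mulr0 expr0n gtn_eqF //.
exact: ltnW (finNzRing_gt1 Fr).
Qed.

Lemma frobenius_line_invariant c :
  @frobenius F K @` frobenius_line c `<=` frobenius_line c.
Proof.
move=> _ [x xr <-]; rewrite /frobenius_line /frobenius /= exprAC xr exprMn.
by rewrite -rmorphXn expf_card.
Qed.

(** By [expr_tower] every X^(r^i) acts on the line as a scalar, so f does too. At a nonzero v, being
    a root of f thus amounts to Psi(c) = 0. *)
Lemma horner_trinomial_line m (a b c : F) v : frobenius_line c v ->
  (map_poly iota (additive_trinomial r m a b)).[v] =
  iota (projective_poly r m a b).[c] * v.
Proof.
move=> vr; rewrite horner_projective_poly /additive_trinomial.
rewrite !rmorphD /= !map_polyZ /= !map_polyXn map_polyX !hornerE.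
rewrite (expr_tower _ _ vr) ?finNzRing_gt1 // vr rmorphXn rmorphM.
by rewrite !mulrDl mulrA.
Qed.

(** Since Psi(0) = b, the condition on b excludes the root 0, whose solution set is not a line. *)
Lemma roots_subspaces_bij m (a b : F) : (0 < m)%N -> b != 0 ->
  one_to_one [set c : F | root (projective_poly r m a b) c]
             (invariant_subspaces j iota 1 (additive_trinomial r m a b)).
Proof.
move=> m_gt0 b_neq0; set f := additive_trinomial r m a b.
have r_gt1 : (1 < r)%N := finNzRing_gt1 Fr.
have root_neq0 c : root (projective_poly r m a b) c -> c != 0.
  apply: contraTneq => ->; rewrite rootE horner_projective_poly expr0n.
  by rewrite gtn_eqF ?geom_exponent_gt0 // mulr0 !add0r.
exists frobenius_line; split.
- move=> c /= root_c.
  have [v v_neq0 vL] := frobenius_line_neq0 (root_neq0 c root_c).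
  split; [exact: frobenius_line_subspace | | | exact: frobenius_line_invariant].
    move=> x xL; rewrite /root_space /= rootE.
    rewrite (horner_trinomial_line _ _ _ xL).
    by rewrite (rootP root_c) rmorph0 mul0r.
  by apply/has_dim1P; exists v => //; apply: frobenius_line_span.
- move=> c1 c2; rewrite !inE /= => root_c1 _ eqL.
  (* Any nonzero v on the line recovers c as v^r / v. *)
  have [v v_neq0 v1] := frobenius_line_neq0 (root_neq0 c1 root_c1).
  have := v1; rewrite eqL /= => v2; apply: (fmorph_inj iota).
  by apply: (mulIf v_neq0); rewrite -v1 -v2.
- move=> U [_ subU /has_dim1P[v v_neq0 UE] invU].
  have vU : U v by rewrite UE; exists 1 => //; rewrite /Fr_scale !rmorph1 mul1r.
  have [s sE] : exists s, Fr_scale j iota s v = @frobenius F K v.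
    have : U (@frobenius F K v) by apply: invU; exists v.
    by rewrite UE => -[s _ sE]; exists s.
  (* [v] is an eigenvector of Frobenius with eigenvalue [s] in [Fr], so
     [v ^ (r - 1)] is fixed by Frobenius because [s ^ (r - 1) = 1]. *)
  have [c cE] : exists c, iota c = v ^+ r / v.
    apply: fixed_expr_card; rewrite expr_div_n exprAC.
    rewrite -[v ^+ #|F|]/(@frobenius F K v) -sE expr_Fr_scale /Fr_scale.
    rewrite -mulf_div divff ?mul1r // !fmorph_eq0.
    (* The eigenvalue s is nonzero because a power of the nonzero v cannot vanish. *)
    apply/eqP => s0; move: sE; rewrite s0 /Fr_scale /frobenius !rmorph0 mul0r.
    by move/esym/eqP; rewrite expf_eq0 (negPf v_neq0) andbF.
  have vL : frobenius_line c v by rewrite /frobenius_line /= cE divfK.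
  exists c; last by rewrite UE (frobenius_line_span v_neq0 vL).
  have := subU _ vU; rewrite /root_space /= !rootE.
  rewrite (horner_trinomial_line _ _ _ vL).
  by rewrite mulf_eq0 (negPf v_neq0) orbF fmorph_eq0.
Qed.

End Lines.

Unset Implicit Arguments.
Set Strict Implicit.

(** Invariant lines are compared only for b nonzero: if a = b = 0, then 0 is a root of Psi while V_f
    is zero and contains no line. *)
Theorem proposition3p2 (p k r d m : nat) (Fr F : finFieldType)
    (K : closedFieldType)
    (j : {rmorphism Fr -> F}) (iota : {rmorphism F -> K}) (a b : F)
    (p_prime : prime p) (k_gt0 : (0 < k)%N) (r_eq : r = (p ^ k)%N)
    (d_gt0 : (0 < d)%N) (card_Fr : #|Fr| = r) (card_F : #|F| = (r ^ d)%N)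
    (K_algebraic : integralRange iota) (m_ge2 : (2 <= m)%N) :
  let f := additive_trinomial r m a b in
  let components := right_component_deg r r f in
  let roots := [set c : F | root (projective_poly r m a b) c] in
  let subspaces := invariant_subspaces j iota 1 f in
  one_to_one components roots /\
  (b != 0 -> one_to_one components subspaces /\ one_to_one roots subspaces).
Proof.
have pchar_F : p \in [pchar F].
  by apply: (@card_finPcharP F p (k * d)) => //; rewrite card_F r_eq expnM.
have pchar_nat (R : nzRingType) : p \in [pchar R] -> [pchar R].-nat r.
  by move=> pR; rewrite (eq_pnat _ (pcharf_eq pR)) r_eq pnatX pnat_id.
move=> f components roots subspaces.
have comp_roots : one_to_one components roots.
  apply: components_roots_bij (pchar_nat _ pchar_F).
  by rewrite -card_Fr finNzRing_gt1.
split=> // b_neq0.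
have roots_sub : one_to_one roots subspaces.
  (* The results on lines take r to be the cardinality of [Fr]. *)
  rewrite /roots /subspaces /f -card_Fr.
  apply: roots_subspaces_bij => //; last exact: ltnW.
  by rewrite card_Fr; apply/pchar_nat/(rmorph_pchar iota).
by split=> //; apply: one_to_one_trans comp_roots roots_sub.
Qed.
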